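(* Let $\tilde E\subset\mathbb{R}^3$ be a normalized convex, cuboidal hexahedron (see context). There exist constants $s,t\in\mathbb{R}$ such that, if the supplemental functions $\sigma_0,\sigma_1,\sigma_2,\sigma_3,\sigma_4^*,\sigma_5^*$ on $\tilde E$ are divergence-free, have vanishing normal flux on the faces $f_0,f_2,f_4$, and have normal fluxes $(\,\cdot\,\cdot\nu_1|_{f_1},\ \cdot\,\cdot\nu_3|_{f_3},\ \cdot\,\cdot\nu_5|_{f_5})$ on $f_1,f_3,f_5$ given respectively by the rows of $$\begin{bmatrix} x_2-c_2^1&0&0\\ x_3-c_3^1&0&0\\ 0&x_1-c_1^3&0\\ 0&x_3-c_3^3&0\\ (-|f_5|c_1^5+t)/|f_1|&-t/|f_3|&x_1\\ -s/|f_1|&(-|f_5|c_2^5+s)/|f_3|&x_2 \end{bmatrix},$$ where $c_\ell^i$ is the average over face $f_i$ of the variable $x_\ell$ and $|f_i|$ is the area of $f_i$, then they provide independent flux degrees of freedom.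
   Context: A convex, cuboidal hexahedron is a (nondegenerate) convex polyhedron in $\mathbb{R}^3$, combinatorially a cube, with six flat quadrilateral faces $f_0,\dots,f_5$, where $f_{2k}$ and $f_{2k+1}$ ($k=0,1,2$) are opposite, and vertices $\mathbf{x}_{ijk}=f_i\cap f_j\cap f_k$ with $i\in\{0,1\}$, $j\in\{2,3\}$, $k\in\{4,5\}$. $\nu_i$ denotes the outer unit normal to $f_i$. Any such hexahedron can be mapped affinely to a normalized one $\tilde E$, for which $\mathbf{x}_{024}=0$, $\mathbf{x}_{124}=\mathbf{e}_1$, $\mathbf{x}_{034}=\mathbf{e}_2$, $\mathbf{x}_{025}=\mathbf{e}_3$ (standard basis vectors), so that $\nu_0=-\mathbf{e}_1$, $\nu_2=-\mathbf{e}_2$, $\nu_4=-\mathbf{e}_3$. $\mathbb{P}_1$ is the space of polynomials of degree at most 1 on $\mathbb{R}^3$, and $\mathbb{P}_1(f_i)$ the space of restrictions to $f_i$ (of dimension 3). The supplemental functions $\sigma$ are vector functions on $\tilde E$ with well-defined normal traces on the faces. That the six supplemental functions ''provide independent flux degrees of freedom'' means that, on the 18-dimensional space $\mathbb{P}_1^3\oplus\mathrm{span}\{\text{the six supplemental functions}\}$, the normal flux map $\mathbf{u}\mapsto(\mathbf{u}\cdot\nu_0|_{f_0},\dots,\mathbf{u}\cdot\nu_5|_{f_5})$ is a bijection onto $\prod_{i=0}^5\mathbb{P}_1(f_i)$. *)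

(* Defs.v *)
From HB Require Import structures.
From mathcomp Require Import all_boot all_order all_algebra.
From mathcomp Require Import all_classical all_reals all_analysis.

Set Implicit Arguments.
Unset Strict Implicit.
Unset Printing Implicit Defensive.

Import Order.TTheory GRing.Theory Num.Theory.
Import numFieldNormedType.Exports.

Local Open Scope classical_set_scope.
Local Open Scope ring_scope.


(* The variable x_l (l = 1, 2, 3) of a point x is the entry x 0 (l - 1). *)
Section Space.
Variable R : realType.
Implicit Types x y : 'rV[R]_3.

Definition mk3 (a b c : R) : 'rV[R]_3 := \row_(l < 3) nth 0 [:: a; b; c] l.

Definition unit3 (l : 'I_3) : 'rV[R]_3 := delta_mx 0 l.

Definition dot x y : R := \sum_(l < 3) x 0 l * y 0 l.

Definition cross x y : 'rV[R]_3 :=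
  mk3 (x 0 1 * y 0 2 - x 0 2 * y 0 1)
      (x 0 2 * y 0 0 - x 0 0 * y 0 2)
      (x 0 0 * y 0 1 - x 0 1 * y 0 0).

(* Euclidean norm; the library's norm on row vectors is the sup norm. *)
Definition enorm x : R := Num.sqrt (dot x x).

Definition vol3 := ((@lebesgue_measure R \x @lebesgue_measure R)
                      \x @lebesgue_measure R)%E.

Definition of_triple (z : R * R * R) : 'rV[R]_3 := mk3 z.1.1 z.1.2 z.2.

Definition volume_integral (A : set 'rV[R]_3) (f : 'rV[R]_3 -> R) : R :=
  \int[vol3]_(z in of_triple @^-1` A) f (of_triple z).

Definition square_integrable (A : set 'rV[R]_3) (f : 'rV[R]_3 -> R) : Prop :=
  measurable_fun (of_triple @^-1` A) (f \o of_triple) /\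
  vol3.-integrable (of_triple @^-1` A) (fun z => ((f (of_triple z)) ^+ 2)%:E).

Definition grad (phi : 'rV[R]_3 -> R) x : 'rV[R]_3 :=
  \row_l 'D_(unit3 l) phi x.

Definition C1 (phi : 'rV[R]_3 -> R) : Prop :=
  [/\ continuous phi,
      forall l x, derivable phi x (unit3 l)
    & forall l, continuous (fun x => 'D_(unit3 l) phi x)].

Definition test_function (A : set 'rV[R]_3) (phi : 'rV[R]_3 -> R) : Prop :=
  [/\ C1 phi,
      compact (closure [set x | phi x != 0])
    & closure [set x | phi x != 0] `<=` interior A].

End Space.

Section Hexahedron.
Variable R : realType.

(* x_{ijk} with i in {0,1}, j in {2,3}, k in {4,5} is indexed by the booleans
   a, b, c such that i = a, j = 2 + b, k = 4 + c; this is whether f_m is one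
   of the three faces f_i, f_j, f_k. *)
Definition incident (m : 'I_6) (a b c : bool) : bool :=
  nth false [:: ~~ a; a; ~~ b; b; ~~ c; c] m.

Definition halfspaces (nu : 'I_6 -> 'rV[R]_3) (off : 'I_6 -> R) :
  set 'rV[R]_3 := [set x | forall m, dot (nu m) x <= off m].

Definition halfspaces_face (nu : 'I_6 -> 'rV[R]_3) (off : 'I_6 -> R)
  (m : 'I_6) : set 'rV[R]_3 :=
  [set x | halfspaces nu off x /\ dot (nu m) x = off m].

(* The polyhedron is the intersection of the half-spaces nu_m . x <= off_m.
   Every x_{ijk} is the only common point of f_i, f_j, f_k and lies on no other
   face: so the x_{ijk} are eight distinct simple vertices, any two of them
   sharing two faces are joined by an edge, and as these edges exhaust those
   at each x_{ijk} there is no other vertex.  The face lattice is that of a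
   cube; in particular each f_m is a nondegenerate convex quadrilateral and the
   polyhedron has nonempty interior. *)
Record hexahedron := Hexahedron {
  normal : 'I_6 -> 'rV[R]_3;
  offset : 'I_6 -> R;
  vertex : bool -> bool -> bool -> 'rV[R]_3;
  normal_unit : forall m, enorm (normal m) = 1;
  hexahedron_bounded :
    exists M : R, forall x, halfspaces normal offset x -> enorm x <= M;
  vertex_on_face : forall a b c m,
    halfspaces_face normal offset m (vertex a b c) <-> incident m a b c;
  vertex_inter : forall a b c,
    [set x | forall m, incident m a b c -> halfspaces_face normal offset m x]
    = [set vertex a b c] }.

Definition body (E : hexahedron) : set 'rV[R]_3 :=
  halfspaces (normal E) (offset E).

Definition face (E : hexahedron) (m : 'I_6) : set 'rV[R]_3 :=
  halfspaces_face (normal E) (offset E) m.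

Definition normalized (E : hexahedron) : Prop :=
  [/\ vertex E false false false = 0,
      vertex E true false false = unit3 R 0,
      vertex E false true false = unit3 R 1
    & vertex E false false true = unit3 R 2].

(* The vertices of f_m: (0,0), (1,0), (1,1), (0,1) is their cyclic order. *)
Definition face_vertex (E : hexahedron) (m : 'I_6) (p q : bool) : 'rV[R]_3 :=
  if (m < 2)%N then vertex E (odd m) p q
  else if (m < 4)%N then vertex E p (odd m) q
  else vertex E p q (odd m).

(* Bilinear parametrization of f_m by the unit square, and its area element
   | d_1 X x d_2 X |. *)
Definition face_param (E : hexahedron) (m : 'I_6) (w : R * R) : 'rV[R]_3 :=
  let X := face_vertex E m in
  ((1 - w.1) * (1 - w.2)) *: X false false + (w.1 * (1 - w.2)) *: X true false
  + ((1 - w.1) * w.2) *: X false true + (w.1 * w.2) *: X true true.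

Definition face_area_element (E : hexahedron) (m : 'I_6) (w : R * R) : R :=
  let X := face_vertex E m in
  enorm (cross
    ((1 - w.2) *: (X true false - X false false)
       + w.2 *: (X true true - X false true))
    ((1 - w.1) *: (X false true - X false false)
       + w.1 *: (X true true - X true false))).

Definition square_measure := (@lebesgue_measure R \x @lebesgue_measure R)%E.

Definition unit_square : set (R * R) := `[0, 1]%classic `*` `[0, 1]%classic.

Definition face_integrable (E : hexahedron) (m : 'I_6) (g : 'rV[R]_3 -> R) :=
  square_measure.-integrable unit_square
    (fun w => (g (face_param E m w) * face_area_element E m w)%:E).

Definition face_integral (E : hexahedron) (m : 'I_6) (g : 'rV[R]_3 -> R) : R :=
  \int[square_measure]_(w in unit_square)
    (g (face_param E m w) * face_area_element E m w).

Definition area (E : hexahedron) (m : 'I_6) : R := face_integral E m (fun=> 1).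

(* [face_avg E m l] is c_{l+1}^m. *)
Definition face_avg (E : hexahedron) (m : 'I_6) (l : 'I_3) : R :=
  face_integral E m (fun x => x 0 l) / area E m.

End Hexahedron.

Section Fluxes.
Variable R : realType.
Implicit Types (E : hexahedron R) (u : 'rV[R]_3 -> 'rV[R]_3).

Definition flux E u (m : 'I_6) (x : 'rV[R]_3) : R := dot (u x) (normal E m).

Definition weak_divergence E u (g : 'rV[R]_3 -> R) : Prop :=
  forall phi, test_function (body E) phi ->
    volume_integral (body E) (fun x => dot (u x) (grad phi x))
    = - volume_integral (body E) (fun x => g x * phi x).

(* A field with square-integrable components is divergence-free when its
   distributional divergence in the interior of E vanishes; it need not be
   differentiable (e.g. it may be piecewise polynomial on a subdivision). *)
Definition divergence_free E u : Prop :=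
  (forall l, square_integrable (body E) (fun x => u x 0 l)) /\
  weak_divergence E u (fun=> 0).

(* u is in H(div; E) and its boundary values u . nu_m on the faces are its
   normal traces, i.e. they satisfy Green's formula. *)
Definition has_normal_traces E u : Prop :=
  [/\ forall l, square_integrable (body E) (fun x => u x 0 l),
      forall m, face_integrable E m (flux E u m)
    & exists g : 'rV[R]_3 -> R,
      [/\ square_integrable (body E) g,
          weak_divergence E u g
        & forall phi, C1 phi ->
          volume_integral (body E)
            (fun x => dot (u x) (grad phi x) + g x * phi x)
          = \sum_(m < 6) face_integral E m (fun x => flux E u m x * phi x)]].

Definition P1 : set ('rV[R]_3 -> R) :=
  [set p | exists (c : R) (w : 'rV[R]_3), p = (fun x => c + dot w x)].

Definition P1_vec : set ('rV[R]_3 -> 'rV[R]_3) :=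
  [set p | forall l, P1 (fun x => p x 0 l)].

(* Functions on a subset A of R^3 are represented by their extension by 0. *)
Definition on (V : zmodType) (A : set 'rV[R]_3) (f : 'rV[R]_3 -> V) :
  'rV[R]_3 -> V := patch (fun=> 0) A f.

Definition combination (p : 'rV[R]_3 -> 'rV[R]_3)
  (sigma : 'I_6 -> 'rV[R]_3 -> 'rV[R]_3) (a : 'I_6 -> R) :
  'rV[R]_3 -> 'rV[R]_3 := fun x => p x + \sum_(j < 6) a j *: sigma j x.

(* The sum P_1^3 + span {sigma_j} of spaces of functions on E. *)
Definition trial_space E (sigma : 'I_6 -> 'rV[R]_3 -> 'rV[R]_3) :
  set ('rV[R]_3 -> 'rV[R]_3) :=
  [set u | exists p a, P1_vec p /\ u = on (body E) (combination p sigma a)].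

(* P_1(f_0) x ... x P_1(f_5) *)
Definition P1_faces E : set ('I_6 -> 'rV[R]_3 -> R) :=
  [set q | forall m, exists2 p, P1 p & q m = on (face E m) p].

Definition flux_map E u : 'I_6 -> 'rV[R]_3 -> R :=
  fun m => on (face E m) (flux E u m).

(* The first clause says that the trial space is the direct sum of P_1^3, of
   dimension 12, and of the span of six linearly independent functions. *)
Definition independent_flux_dofs E (sigma : 'I_6 -> 'rV[R]_3 -> 'rV[R]_3) :
  Prop :=
  (forall p a, P1_vec p ->
     (forall x, body E x -> combination p sigma a x = 0) ->
     (forall x, p x = 0) /\ (forall j, a j = 0)) /\
  set_bij (trial_space E sigma) (P1_faces E) (flux_map E).

(* Row j holds the normal fluxes of the j-th supplemental function on f_1, f_3
   and f_5. *)
Definition flux_table E (s t : R) (j : 'I_6) (x : 'rV[R]_3) : seq R :=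
  let c := face_avg E in
  let A := area E in
  nth [::]
   [:: [:: x 0 1 - c 1 1; 0;             0            ];
       [:: x 0 2 - c 1 2; 0;             0            ];
       [:: 0;             x 0 0 - c 3 0; 0            ];
       [:: 0;             x 0 2 - c 3 2; 0            ];
       [:: (- A 5 * c 5 0 + t) / A 1; - t / A 3; x 0 0];
       [:: - s / A 1; (- A 5 * c 5 1 + s) / A 3; x 0 1]] j.

Definition prescribed_fluxes E (s t : R)
  (sigma : 'I_6 -> 'rV[R]_3 -> 'rV[R]_3) : Prop :=
  forall j (k : 'I_3),
    (forall m : 'I_6, m = k.*2 :> nat ->
       forall x, face E m x -> flux E (sigma j) m x = 0) /\
    (forall m : 'I_6, m = k.*2.+1 :> nat ->
       forall x, face E m x -> flux E (sigma j) m x = (flux_table E s t j x)`_k).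

End Fluxes.

(* Main.v *)
Require Import Defs.
From HB Require Import structures.
From mathcomp Require Import all_boot all_order all_algebra.
From mathcomp Require Import all_classical all_reals all_analysis.
From mathcomp Require Import measurable_realfun.
From mathcomp Require Import ring lra.

(** The flux of an affine field or of a supplemental function through a face is
    an affine function on that face, so the flux map is a linear map between
    two spaces of dimension 18, and the theorem says that it is injective:
    surjectivity is then a dimension count ([corner_fluxes_surj]).

    Let u = p + sum_j a_j sigma_j have zero flux through all the faces
    ([formal_flux_kernel]).  On the coordinate planes f_0, f_2, f_4 only p
    contributes, which forces p = (alpha x_1, beta x_2, gamma x_3).  The values
    of the flux at three vertices of f_5 then give gamma = 0,
    a_4 = - alpha nu_51 and a_5 = - beta nu_52, where nu_il is the l-th
    coordinate of the normal of f_i.  Integrating the flux over f_1 and over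
    f_3 removes sigma_0, ..., sigma_3, whose fluxes have mean zero, and leaves
    two linear equations in alpha and beta.  Put A_il = int_{f_i} nu_il x_l.
    By the divergence theorem A_1l + A_3l + A_5l is the volume for every l
    ([outflow_eq], [outflow_gt0]), while the total fluxes of sigma_4 and sigma_5
    are zero; so the sum of the two equations is (alpha + beta) |E| = 0, and
    the first equation becomes
      alpha (A_11 + A_51 - A_12 - nu_51 t - nu_52 s) = 0.
    Suitable s and t make the second factor nonzero ([balance_parameters]).
    This is immediate when f_5 is not parallel to f_4.  When it is, A_51 = 0
    and A_11 - A_12 is positive: it is the integral, over the heights x_3 in
    [0, 1], of the product x_1 x_2 along the edge common to f_1 and f_3
    ([horizontal_top_gt0]).

    The integrals are computed exactly.  The faces are flat, so the area
    element of the bilinear parametrization of f_i times nu_i is, up to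
    orientation, the cross product of the tangent vectors.  Hence A_il is a
    polynomial in the coordinates of the vertices, and the divergence theorem
    is an identity between such polynomials. *)

Set Implicit Arguments.
Unset Strict Implicit.
Unset Printing Implicit Defensive.

Import Order.TTheory GRing.Theory Num.Theory.
Import numFieldNormedType.Exports.

Local Open Scope classical_set_scope.
Local Open Scope ring_scope.

(** * Products of bilinear functions on the unit square *)

Section SquareIntegral.
Variable R : realType.
Local Notation mu := (@lebesgue_measure R).

Lemma quadratic_integral (a b c : R) :
  (\int[mu]_(x in `[0%R, 1%R]) (a + b * x + c * x ^+ 2)%:E)%E
  = (a + b / 2 + c / 3)%:E.
Proof.
pose F (x : R) : R := a * x + b / 2 * x ^+ 2 + c / 3 * x ^+ 3.
have dF (x : R) : is_derive x 1 F (a + b * x + c * x ^+ 2).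
  rewrite /F; apply: is_derive_eq.
  by rewrite /GRing.scale /=; field.
have cF : continuous F.
  by move=> y; apply/differentiable_continuous/derivable1_diffP; apply: ex_derive.
have cf : continuous (fun x : R => a + b * x + c * x ^+ 2).
  move=> y; apply/differentiable_continuous/derivable1_diffP.
  exact: ex_derive.
rewrite (continuous_FTC2 (F := F) ltr01 (continuous_subspaceT cf)).
- by rewrite -EFinB /F; congr EFin; field.
- split.
  + by move=> x _; apply: ex_derive.
  + exact/cvg_at_right_filter/cF.
  + exact/cvg_at_left_filter/cF.
- by move=> x _; rewrite derive1E derive_val.
Qed.

(** Bilinear interpolation of corner values: the integrand of every face
    integral below is a product of two such functions. *)
Definition interp (a : bool -> bool -> R) (w : R * R) : R :=
  (1 - w.1) * (1 - w.2) * a false false + w.1 * (1 - w.2) * a true false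
  + (1 - w.1) * w.2 * a false true + w.1 * w.2 * a true true.

(** The mass matrix of the bilinear element: the tensor square of the matrix
    with rows (2, 1) / 6 and (1, 2) / 6. *)
Definition mass (a b : bool -> bool -> R) : R :=
  (a false false * (4 * b false false + 2 * b true false
                    + 2 * b false true + b true true)
   + a true false * (2 * b false false + 4 * b true false
                     + b false true + 2 * b true true)
   + a false true * (2 * b false false + b true false
                     + 4 * b false true + 2 * b true true)
   + a true true * (b false false + 2 * b true false
                    + 2 * b false true + 4 * b true true)) / 36.

Local Notation mu2 := (@square_measure R).
Local Notation Q := (@unit_square R).
Local Notation RR := (measurableTypeR R * measurableTypeR R)%type.

Lemma measurable_unit_square : measurable (Q : set RR).
Proof. by apply: measurableX; exact: measurable_itv. Qed.

Lemma unit_square_measure : mu2 Q = 1%E.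
Proof.
have e : mu `[0%R, 1%R]%classic = 1%E.
  by rewrite lebesgue_measure_itv /= lte_fin ltr01 sube0.
rewrite /square_measure product_measure1E; try exact: measurable_itv.
by rewrite [X in (X * _)%E]e [X in (_ * X)%E]e mule1.
Qed.

Lemma interp_measurable a :
  measurable_fun setT (interp a : RR -> R).
Proof.
have m1 : measurable_fun setT (fun w : R * R => w.1) by exact: measurable_fst.
have m2 : measurable_fun setT (fun w : R * R => w.2) by exact: measurable_snd.
rewrite /interp.
by repeat first [exact: m1 | exact: m2 | exact: measurable_cst
  | apply: measurable_funM | apply: measurable_funD | apply: measurable_funN].
Qed.

Lemma interp_bound a w : Q w ->
  `|interp a w| <= `|a false false| + `|a true false| + `|a false true| + `|a true true|.
Proof.
case=> /=; rewrite !in_itv /= => /andP[u0 u1] /andP[v0 v1].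
have bnd (s t x : R) : 0 <= s <= 1 -> 0 <= t <= 1 -> `|s * t * x| <= `|x|.
  move=> /andP[s0 s1] /andP[t0 t1]; rewrite !normrM (ger0_norm s0) (ger0_norm t0).
  by apply: ler_piMl => //; exact: mulr_ile1.
rewrite /interp; do 3!(apply: (le_trans (ler_normD _ _)); apply: lerD;
  last by apply: bnd; lra).
by apply: bnd; lra.
Qed.

Lemma interpM_integrable a b :
  mu2.-integrable Q
   (EFin \o (fun w => interp a w * interp b w)).
Proof.
apply: measurable_bounded_integrable.
- exact: measurable_unit_square.
- have: (mu2 Q < +oo)%E by rewrite unit_square_measure ltry.
  exact.
- apply: (measurable_funS measurableT) => //.
  by apply: measurable_funM; exact: interp_measurable.
- exists ((`|a false false| + `|a true false| + `|a false true| + `|a true true|)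
        * (`|b false false| + `|b true false| + `|b false true| + `|b true true|)).
  split; first by rewrite num_real.
  move=> M /ltW ltM w Qw /=; apply: le_trans ltM; rewrite normrM.
  by apply: ler_pM => //; exact: interp_bound.
Qed.

Lemma interpM_integral a b :
  \int[mu2]_(w in Q) (interp a w * interp b w)
  = mass a b.
Proof.
set f := fun w => _ * _.
rewrite /Rintegral.
have := interpM_integrable a b.
rewrite -/f => fi; have fint := (integrable_mkcond _ measurable_unit_square).1 fi.
rewrite integral_mkcond -integral12_prod_meas1 //.
(* At fixed u both factors are affine in v: A + (B - A) v and C + (D - C) v. *)
pose A (u : R) := (1 - u) * a false false + u * a true false.
pose B (u : R) := (1 - u) * a false true + u * a true true.
pose C (u : R) := (1 - u) * b false false + u * b true false.
pose D (u : R) := (1 - u) * b false true + u * b true true.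
pose q (u : R) := A u * C u + (A u * (D u - C u) + (B u - A u) * C u) / 2
   + (B u - A u) * (D u - C u) / 3.
transitivity (fine (\int[mu]_(u in `[0%R, 1%R]) (q u)%:E)%E).
  congr fine; rewrite [RHS]integral_mkcond; apply: eq_integral => u _.
  rewrite /fubini_F /patch; case: ifPn => [|] uin.
    rewrite -quadratic_integral [RHS]integral_mkcond; apply: eq_integral => v _.
    rewrite /patch.
    have -> : ((u, v) \in Q) = (v \in `[0%R, 1%R]%classic).
      apply/idP/idP; rewrite !in_setE; first by case.
      by split=> //; rewrite in_setE in uin.
    by case: ifP => // _; congr EFin; rewrite /f /interp /A /B /C /D /=; field.
  apply: integral0_eq => v _; case: ifP => //; rewrite in_setE => -[/= hu _].
  by move: uin; rewrite notin_setE.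
(* q is quadratic, so it is recovered from its values at -1, 0 and 1. *)
transitivity (fine (\int[mu]_(u in `[0%R, 1%R])
   (q 0 + ((q 1 - q (-1)) / 2) * u + ((q 1 + q (-1)) / 2 - q 0) * u ^+ 2)%:E)%E).
  congr fine; apply: eq_integral => u _; congr EFin.
  by rewrite /q /A /B /C /D; field.
by rewrite quadratic_integral /= /q /A /B /C /D /mass; field.
Qed.

End SquareIntegral.

(** * Vectors in space *)

Section Vectors.
Variable R : realType.
Implicit Types (x y n : 'rV[R]_3).

Lemma sum3 (f : 'I_3 -> R) : \sum_(l < 3) f l = f 0 + f 1 + f 2.
Proof.
rewrite !big_ord_recl big_ord0 addr0 addrA.
by congr (f _ + f _ + f _); apply: val_inj.
Qed.

Lemma dotE x y : dot x y = x 0 0 * y 0 0 + x 0 1 * y 0 1 + x 0 2 * y 0 2.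
Proof. exact: sum3. Qed.

Lemma mk3E (a b c : R) :
  (mk3 a b c 0 0 = a) * (mk3 a b c 0 1 = b) * (mk3 a b c 0 2 = c).
Proof. by rewrite /mk3 !mxE. Qed.

Lemma forall3 (P : 'I_3 -> Prop) : P 0 -> P 1 -> P 2 -> forall l, P l.
Proof.
move=> P0 P1 P2 [[|[|[|//]]] hl].
- by rewrite (_ : Ordinal hl = 0) //; apply: val_inj.
- by rewrite (_ : Ordinal hl = 1) //; apply: val_inj.
- by rewrite (_ : Ordinal hl = 2) //; apply: val_inj.
Qed.

Lemma unit_dot n : enorm n = 1 -> dot n n = 1.
Proof.
move=> n1; have n0 : 0 <= dot n n by rewrite dotE; nra.
by rewrite -(sqr_sqrtr n0) -/(enorm n) n1 expr1n.
Qed.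

(** Both sides are orthogonal to x and y.  In coordinates, with w = cross x y,
    this is (n . n) w - (n . w) n = n cross (w cross n), and w cross n is a
    combination of x and y with coefficients n . x and n . y. *)
Lemma cross_parallel n x y : dot n n = 1 -> dot n x = 0 -> dot n y = 0 ->
  forall l, cross x y 0 l = dot n (cross x y) * n 0 l.
Proof.
rewrite !dotE => n1 nx ny.
have parallel (u v w1 w2 : R) :
    (n 0 0 * n 0 0 + n 0 1 * n 0 1 + n 0 2 * n 0 2) * u
      = v + (n 0 0 * x 0 0 + n 0 1 * x 0 1 + n 0 2 * x 0 2) * w1
          - (n 0 0 * y 0 0 + n 0 1 * y 0 1 + n 0 2 * y 0 2) * w2 -> u = v.
  by rewrite n1 nx ny mul1r !mul0r addr0 subr0.
apply: forall3; rewrite /cross !mk3E.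
- apply: (parallel _ _ (n 0 1 * y 0 2 - n 0 2 * y 0 1)
                       (n 0 1 * x 0 2 - n 0 2 * x 0 1)); ring.
- apply: (parallel _ _ (n 0 2 * y 0 0 - n 0 0 * y 0 2)
                       (n 0 2 * x 0 0 - n 0 0 * x 0 2)); ring.
- apply: (parallel _ _ (n 0 0 * y 0 1 - n 0 1 * y 0 0)
                       (n 0 0 * x 0 1 - n 0 1 * x 0 0)); ring.
Qed.

Lemma enormZ (k : R) n : enorm n = 1 -> enorm (k *: n) = `|k|.
Proof.
move/unit_dot; rewrite /enorm !dotE !mxE => n1.
rewrite -sqrtr_sqr; congr Num.sqrt.
by rewrite -[RHS]mulr1 -n1; ring.
Qed.

Lemma dot0 x : dot x 0 = 0.
Proof. by rewrite dotE !mxE; ring. Qed.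

Lemma dot_unit3 x l : dot x (unit3 R l) = x 0 l.
Proof.
by move: l; apply: forall3; rewrite dotE /unit3 !mxE /=; ring.
Qed.

End Vectors.

(** * Vertices and faces *)

Section Incidence.
Variables (R : realType) (E : hexahedron R).
Local Notation V := (vertex E).
Local Notation nu := (normal E).

Lemma vertex_dot a b c m : incident m a b c -> dot (nu m) (V a b c) = offset E m.
Proof. by move/(vertex_on_face E a b c m) => []. Qed.

Lemma vertex_body a b c : body E (V a b c).
Proof.
have : incident (if a then 1 else 0) a b c by case: a.
by move/(vertex_on_face E a b c _) => [].
Qed.

Lemma vertex_dot_lt a b c m : ~~ incident m a b c ->
  dot (nu m) (V a b c) < offset E m.
Proof.
move=> off; rewrite lt_neqAle vertex_body andbT; apply/negP => /eqP on.
move/negP: off; apply; apply/(vertex_on_face E a b c m).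
by split=> //; exact: vertex_body.
Qed.

Lemma face_vertex1 p q : face_vertex E 1 p q = V true p q. Proof. by []. Qed.
Lemma face_vertex3 p q : face_vertex E 3 p q = V p true q. Proof. by []. Qed.
Lemma face_vertex5 p q : face_vertex E 5 p q = V p q true. Proof. by []. Qed.

Lemma face_vertex_on m p q : face E m (face_vertex E m p q).
Proof.
by case: m => [[|[|[|[|[|[|//]]]]]] hm]; apply/(vertex_on_face E).
Qed.

Lemma face_vertex_dot m p q : dot (nu m) (face_vertex E m p q) = offset E m.
Proof. by case: (face_vertex_on m p q). Qed.

End Incidence.

(** * Integrals over a flat face *)

Section FaceIntegrals.
Variables (R : realType) (E : hexahedron R) (m : 'I_6).
Let n := normal E m.
Let F := face_vertex E m.

(** The tangent vectors of the bilinear parametrization at the corner (p, q);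
    the first depends on q only and the second on p only. *)
Definition face_cross (p q : bool) : 'rV[R]_3 :=
  cross (F true q - F false q) (F p true - F p false).

Definition face_jacobian (p q : bool) : R := dot n (face_cross p q).

Lemma face_crossE p q l : face_cross p q 0 l = face_jacobian p q * n 0 l.
Proof.
have tangent p0 q0 p1 q1 : dot n (F p0 q0 - F p1 q1) = 0.
  transitivity (dot n (F p0 q0) - dot n (F p1 q1)); last first.
    by rewrite !face_vertex_dot subrr.
  by rewrite !dotE !mxE; ring.
by apply: cross_parallel => //; exact/unit_dot/normal_unit.
Qed.

Lemma face_param_affine (c : R) u w :
  c + dot u (face_param E m w) = interp (fun p q => c + dot u (F p q)) w.
Proof. by rewrite /face_param -/F /interp !dotE !mxE; ring. Qed.

(** On a flat face the tangent vectors span the plane of the face, so that their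
    cross product is a multiple of the normal; the multiple is bilinear on the
    square, and e is its sign, which convexity makes constant. *)
Lemma face_area_elementE e : e ^+ 2 = 1 ->
  (forall p q, 0 < e * face_jacobian p q) ->
  forall w, unit_square w ->
  face_area_element E m w = e * interp face_jacobian w.
Proof.
move=> e1 epos w [/=]; rewrite !in_itv /= => /andP[u0 u1] /andP[v0 v1].
rewrite /face_area_element -/F; set A := _ + _; set B := _ + _.
have nA : dot n A = 0.
  transitivity ((1 - w.2) * (dot n (F true false) - dot n (F false false))
    + w.2 * (dot n (F true true) - dot n (F false true))).
    by rewrite /A !dotE !mxE; ring.
  by rewrite !face_vertex_dot !subrr !mulr0 addr0.
have nB : dot n B = 0.
  transitivity ((1 - w.1) * (dot n (F false true) - dot n (F false false))
    + w.1 * (dot n (F true true) - dot n (F true false))).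
    by rewrite /B !dotE !mxE; ring.
  by rewrite !face_vertex_dot !subrr !mulr0 addr0.
have nu := normal_unit E m.
have -> : cross A B = dot n (cross A B) *: n.
  by apply/rowP => l; rewrite [RHS]mxE; apply: cross_parallel => //; exact: unit_dot.
rewrite enormZ //.
have -> : dot n (cross A B) = interp face_jacobian w.
  by rewrite /face_jacobian /face_cross /interp /cross !dotE !mk3E /A /B !mxE; ring.
have pos : 0 <= e * interp face_jacobian w.
  have -> : e * interp face_jacobian w = interp (fun p q => e * face_jacobian p q) w.
    by rewrite /interp; ring.
  rewrite /interp; do 3?apply: addr_ge0;
    by apply: mulr_ge0; last exact/ltW/epos; rewrite mulr_ge0 ?subr_ge0.
have n1 : `|e| = 1.
  by apply/eqP; rewrite -(@eqrXn2 _ 2) // ?normr_ge0 // -normrX e1 normr1 expr1n.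
by rewrite -[LHS]mul1r -n1 -normrM ger0_norm.
Qed.

Lemma face_integral_affine e (c : R) u : e ^+ 2 = 1 ->
  (forall p q, 0 < e * face_jacobian p q) ->
  face_integral E m (fun x => c + dot u x)
  = e * mass (fun p q => c + dot u (F p q)) face_jacobian.
Proof.
move=> e1 epos; rewrite /face_integral.
under eq_Rintegral => w win.
  rewrite in_setE in win.
  rewrite face_param_affine (face_area_elementE e1 epos win) mulrCA.
  over.
rewrite RintegralZl ?interpM_integral //; first exact: measurable_unit_square.
exact: interpM_integrable.
Qed.

End FaceIntegrals.

(** * Normals and vertices of a normalized hexahedron *)

Lemma sqr1_lt0 (R : realFieldType) (t : R) : t * t = 1 -> t < 0 -> t = -1.
Proof. by move=> t2 t0; nra. Qed.

Section NormalizedGeometry.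
Variables (R : realType) (E : hexahedron R).
Hypothesis hE : normalized E.
Local Notation V := (vertex E).
Local Notation nu := (normal E).

(** f_{2k} contains the origin and the two basis vectors other than e_k, so its
    normal is e_k up to sign; the remaining basis vector lies strictly inside
    the half-space, which fixes the sign. *)
Lemma normal_low (k : 'I_3) (m : 'I_6) : m = k.*2 :> nat ->
  offset E m = 0 /\ forall x, dot (nu m) x = - x 0 k.
Proof.
move=> mk; case: hE => V0 V1 V2 V3.
have h0 := @vertex_dot _ E false false false m; rewrite V0 dot0 in h0.
have h1 := @vertex_dot _ E true false false m; rewrite V1 dot_unit3 in h1.
have h2 := @vertex_dot _ E false true false m; rewrite V2 dot_unit3 in h2.
have h3 := @vertex_dot _ E false false true m; rewrite V3 dot_unit3 in h3.
have g1 := @vertex_dot_lt _ E true false false m; rewrite V1 dot_unit3 in g1.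
have g2 := @vertex_dot_lt _ E false true false m; rewrite V2 dot_unit3 in g2.
have g3 := @vertex_dot_lt _ E false false true m; rewrite V3 dot_unit3 in g3.
have n1 := unit_dot (normal_unit E m); rewrite dotE in n1.
move: k mk; apply: forall3 => mk; rewrite /incident mk /= in h0 h1 h2 h3 g1 g2 g3.
- move: (h0 isT) (h2 isT) (h3 isT) (g1 isT) => <- e2 e3 lt1; split=> // x.
  rewrite dotE e2 e3 (@sqr1_lt0 _ (nu m 0 0)) //; first by ring.
  by move: n1; rewrite e2 e3 !mul0r !addr0.
- move: (h0 isT) (h1 isT) (h3 isT) (g2 isT) => <- e1 e3 lt2; split=> // x.
  rewrite dotE e1 e3 (@sqr1_lt0 _ (nu m 0 1)) //; first by ring.
  by move: n1; rewrite e1 e3 !mul0r addr0 add0r.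
- move: (h0 isT) (h1 isT) (h2 isT) (g3 isT) => <- e1 e2 lt3; split=> // x.
  rewrite dotE e1 e2 (@sqr1_lt0 _ (nu m 0 2)) //; first by ring.
  by move: n1; rewrite e1 e2 !mul0r !add0r.
Qed.

(** f_{2k+1} contains e_k, and the origin lies strictly inside its half-space.
    Hence its plane is a graph over the other two coordinates. *)
Lemma normal_high (k : 'I_3) (m : 'I_6) : m = k.*2.+1 :> nat ->
  offset E m = nu m 0 k /\ 0 < nu m 0 k.
Proof.
move=> mk; case: hE => V0 V1 V2 V3.
have h1 := @vertex_dot _ E true false false m; rewrite V1 dot_unit3 in h1.
have h2 := @vertex_dot _ E false true false m; rewrite V2 dot_unit3 in h2.
have h3 := @vertex_dot _ E false false true m; rewrite V3 dot_unit3 in h3.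
have g0 := @vertex_dot_lt _ E false false false m; rewrite V0 dot0 in g0.
move: k mk; apply: forall3 => mk; rewrite /incident mk /= in h1 h2 h3 g0.
- by rewrite h1 ?g0.
- by rewrite h2 ?g0.
- by rewrite h3 ?g0.
Qed.

Lemma vertex_coord a b c (k : 'I_3) :
  (nth false [:: a; b; c] k -> 0 < V a b c 0 k) /\
  (~~ nth false [:: a; b; c] k -> V a b c 0 k = 0).
Proof.
have lt6 : (k.*2 < 6)%N by rewrite -[6%N]/(3.*2)%N ltn_double.
have [off0 dotk] := @normal_low k (Ordinal lt6) erefl.
have on := @vertex_dot _ E a b c (Ordinal lt6).
have out := @vertex_dot_lt _ E a b c (Ordinal lt6).
rewrite off0 dotk in on out.
have inc : incident (Ordinal lt6) a b c = ~~ nth false [:: a; b; c] k.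
  by move: k lt6 {off0 dotk on out}; apply: forall3 => lt6.
rewrite inc in on out; rewrite negbK in out; split=> kth.
  by have := out kth; rewrite oppr_lt0.
by apply/eqP; rewrite -oppr_eq0; apply/eqP/on.
Qed.

End NormalizedGeometry.

(** * Orientation of the faces and first moments *)

(** Four points of a plane project, along the first axis, to (0, 0), (q, 0),
    (0, r) and (b, c).  If an affine function d - h vanishes at the second and
    the fourth and is positive at the other two, then the projected
    quadrilateral turns left at (b, c): its fourth corner lies strictly on the
    outer side of the diagonal from (q, 0) to (0, r). *)
Lemma quadrilateral_convex (R : realFieldType)
  (n0 n1 n2 h0 h1 h2 d x00 x10 x01 x11 q b r c : R) :
  0 < n0 ->
  n0 * x10 + n1 * q = n0 * x00 -> n0 * x01 + n2 * r = n0 * x00 ->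
  n0 * x11 + n1 * b + n2 * c = n0 * x00 ->
  h0 * x00 < d -> h0 * x01 + h2 * r < d ->
  h0 * x10 + h1 * q = d -> h0 * x11 + h1 * b + h2 * c = d ->
  0 < q -> 0 < c -> 0 < r * b + q * c - q * r.
Proof.
move=> n0_gt0 e10 e01 e11 h00 h01 h10 h11 q0 c0.
(* In the plane, the fourth point is an affine combination of the others. *)
have comb : q * r * x11 = b * r * x10 + c * q * x01 + (q * r - b * r - c * q) * x00.
  apply: (mulfI (lt0r_neq0 n0_gt0)); apply/eqP; rewrite -subr_eq0; apply/eqP.
  transitivity (q * r * (n0 * x11 + n1 * b + n2 * c - n0 * x00)
     - b * r * (n0 * x10 + n1 * q - n0 * x00)
     - c * q * (n0 * x01 + n2 * r - n0 * x00)); first by ring.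
  by rewrite e10 e01 e11 !subrr !mulr0 !subr0.
have key : c * q * (d - (h0 * x01 + h2 * r))
    = (r * b + q * c - q * r) * (d - h0 * x00).
  apply/eqP; rewrite -subr_eq0; apply/eqP.
  transitivity (q * r * (d - (h0 * x11 + h1 * b + h2 * c))
     - b * r * (d - (h0 * x10 + h1 * q))
     + h0 * (q * r * x11
       - (b * r * x10 + c * q * x01 + (q * r - b * r - c * q) * x00))).
    by ring.
  by rewrite h10 h11 comb !subrr !mulr0 subr0 addr0.
have lt1 : 0 < d - h0 * x00 by rewrite subr_gt0.
rewrite -(pmulr_lgt0 _ lt1) -key pmulr_rgt0 ?subr_gt0 //.
by rewrite mulr_gt0.
Qed.

Section Faces.
Variables (R : realType) (E : hexahedron R).
Local Notation nu := (normal E).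

(** The k-th coordinate of the cross product is the Jacobian of the projection of
    the face along e_k, up to the sign e of the permutation (k, i, j).  The
    projected quadrilateral has two sides on the coordinate axes and lies in
    the quadrant, so three of its corners are convex; for the fourth,
    the face g through the corners (1, 0) and (1, 1) is the witness. *)
Lemma face_jacobian_gt0 (m g : 'I_6) (k i j : 'I_3) (e : R) :
  let F := face_vertex E m in
  e ^+ 2 = 1 ->
  (forall x y : 'rV[R]_3, dot x y = x 0 k * y 0 k + x 0 i * y 0 i + x 0 j * y 0 j) ->
  (forall x y : 'rV[R]_3, cross x y 0 k = e * (x 0 i * y 0 j - x 0 j * y 0 i)) ->
  0 < nu m 0 k ->
  (forall q, F false q 0 i = 0) -> (forall q, 0 < F true q 0 i) ->
  (forall p, F p false 0 j = 0) -> (forall p, 0 < F p true 0 j) ->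
  (forall q, dot (nu g) (F true q) = offset E g) ->
  (forall q, dot (nu g) (F false q) < offset E g) ->
  forall p q, 0 < e * face_jacobian E m p q.
Proof.
move=> F e1 dotk crossk nk Fi0 Fi Fj0 Fj gon goff p q.
rewrite -(pmulr_lgt0 _ nk) -mulrA -face_crossE // /face_cross crossk mulrA.
rewrite -expr2 e1 mul1r -/F !mxE !Fi0 !Fj0.
have Fm p' q' : dot (nu m) (F p' q') = offset E m by exact: face_vertex_dot.
have := (Fm false false, Fm true false, Fm false true, Fm true true).
have := (goff false, goff true, gon false, gon true).
rewrite !dotk !Fi0 !Fj0 !mulr0 !addr0 => -[[[g1 g2] g3] g4] [[[m1 m2] m3] m4].
have := @quadrilateral_convex _ (nu m 0 k) (nu m 0 i) (nu m 0 j) (nu g 0 k)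
  (nu g 0 i) (nu g 0 j) (offset E g) _ _ _ _ (F true false 0 i) (F true true 0 i)
  (F false true 0 j) (F true true 0 j) nk.
move/(_ (F false false 0 k) (F true false 0 k) (F false true 0 k) (F true true 0 k)).
rewrite m1 m2 m3 m4 => /(_ erefl erefl erefl g1 g2 g3 g4 (Fi false) (Fj true)).
have := (mulr_gt0 (Fi false) (Fj false), mulr_gt0 (Fi false) (Fj true),
  mulr_gt0 (Fi true) (Fj false)).
by case: p; case: q => -[[s1 s2] s3] s4; rewrite ?Fi0 ?Fj0; nra.
Qed.

Definition moment m (l : 'I_3) : R := face_integral E m (fun x => x 0 l).

Section OneFace.
Variables (m : 'I_6) (e : R).

(** The coordinates of the tangential cross product, unfolded to coordinates
    of the corners. *)
Definition face_minor (i j : 'I_3) (p q : bool) : R :=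
  let F := face_vertex E m in
  (F true q 0 i - F false q 0 i) * (F p true 0 j - F p false 0 j)
  - (F true q 0 j - F false q 0 j) * (F p true 0 i - F p false 0 i).

Hypothesis e1 : e ^+ 2 = 1.
Hypothesis epos : forall p q, 0 < e * face_jacobian E m p q.

Lemma momentE l :
  moment m l = e * mass (fun p q => face_vertex E m p q 0 l) (face_jacobian E m).
Proof.
have dotl (x : 'rV[R]_3) : 0 + dot (unit3 R l) x = x 0 l.
  rewrite add0r /dot (bigD1 l) //= big1 => [|i il]; rewrite /unit3 !mxE eqxx.
    by rewrite eqxx mul1r addr0.
  by rewrite (negPf il) mul0r.
rewrite /moment.
transitivity (face_integral E m (fun x => 0 + dot (unit3 R l) x)).
  by congr face_integral; apply/funext => x; rewrite dotl.
rewrite (face_integral_affine 0 (unit3 R l) e1 epos); congr (_ * mass _ _).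
by apply/funext => p; apply/funext => q; rewrite dotl.
Qed.

(** This is what makes the moments polynomial in the vertices: the normal
    absorbs the Jacobian and no square root is left. *)
Lemma normal_momentE :
  let X l := fun p q => face_vertex E m p q 0 l in
  (nu m 0 0 * moment m 0 = e * mass (X 0) (face_minor 1 2)) *
  (nu m 0 1 * moment m 1 = e * mass (X 1) (face_minor 2 0)) *
  (nu m 0 2 * moment m 2 = e * mass (X 2) (face_minor 0 1)).
Proof.
have jac l : nu m 0 l * moment m l = e * mass
    (fun p q => face_vertex E m p q 0 l) (fun p q => face_cross E m p q 0 l).
  by rewrite momentE /mass !face_crossE; field.
split; first split; rewrite jac; congr (_ * mass _ _);
  by apply/funext => p; apply/funext => q; rewrite /face_cross /cross mk3E !mxE.
Qed.

Lemma areaE : area E m = e * mass (fun _ _ => 1) (face_jacobian E m).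
Proof.
rewrite /area.
transitivity (face_integral E m (fun x => 1 + dot 0 x)).
  congr face_integral; apply/funext => x.
  by rewrite dotE !mxE !mul0r !addr0.
rewrite (face_integral_affine 1 0 e1 epos); congr (_ * mass _ _).
apply/funext => p; apply/funext => q.
by rewrite dotE !mxE !mul0r !addr0.
Qed.

Lemma area_gt0 : 0 < area E m.
Proof.
have := (epos false false, epos true false, epos false true, epos true true).
by move=> [[[? ?] ?] ?]; rewrite areaE /mass; nra.
Qed.

Lemma face_integral_moment (c : R) u :
  face_integral E m (fun x => c + dot u x) =
  c * area E m + (u 0 0 * moment m 0 + u 0 1 * moment m 1 + u 0 2 * moment m 2).
Proof.
by rewrite (face_integral_affine c u e1 epos) areaE !momentE /mass !dotE; field.
Qed.

(** Passes from a pointwise identity on a face to its integral; u and c may be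
    nonzero since they need only vanish together on the plane of the face. *)
Lemma affine_vanishing_moment (c : R) u :
  (forall p q, c + dot u (face_vertex E m p q) = 0) ->
  c * area E m + (u 0 0 * moment m 0 + u 0 1 * moment m 1 + u 0 2 * moment m 2)
  = 0.
Proof.
move=> van; rewrite -face_integral_moment (face_integral_affine c u e1 epos).
by rewrite /mass !van !mul0r !addr0 mul0r mulr0.
Qed.

End OneFace.
End Faces.

(** * The divergence theorem for the coordinate fields *)

Section HighFaces.
Variables (R : realType) (E : hexahedron R).
Hypothesis hE : normalized E.
Local Notation V := (vertex E).
Local Notation nu := (normal E).
Local Notation mom := (moment E).

Lemma vertex_coord0 a b c (k : 'I_3) :
  ~~ nth false [:: a; b; c] k -> V a b c 0 k = 0.
Proof. by case: (vertex_coord hE a b c k). Qed.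

Lemma vertex_coord_gt0 a b c (k : 'I_3) :
  nth false [:: a; b; c] k -> 0 < V a b c 0 k.
Proof. by case: (vertex_coord hE a b c k). Qed.

Lemma normal_high1 : offset E 1 = nu 1 0 0 /\ 0 < nu 1 0 0.
Proof. exact: (@normal_high _ _ hE 0). Qed.
Lemma normal_high3 : offset E 3 = nu 3 0 1 /\ 0 < nu 3 0 1.
Proof. exact: (@normal_high _ _ hE 1). Qed.
Lemma normal_high5 : offset E 5 = nu 5 0 2 /\ 0 < nu 5 0 2.
Proof. exact: (@normal_high _ _ hE 2). Qed.

Lemma jacobian1 p q : 0 < 1 * face_jacobian E 1 p q.
Proof.
apply: (@face_jacobian_gt0 _ E 1 3 0 1 2).
- exact: expr1n.
- exact: dotE.
- by move=> x y; rewrite /cross mk3E mul1r.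
- by case: normal_high1.
- by move=> b; rewrite face_vertex1 vertex_coord0.
- by move=> b; rewrite face_vertex1 vertex_coord_gt0.
- by move=> b; rewrite face_vertex1 vertex_coord0.
- by move=> b; rewrite face_vertex1 vertex_coord_gt0.
- by move=> b; rewrite face_vertex1 vertex_dot.
- by move=> b; rewrite face_vertex1 vertex_dot_lt.
Qed.

Lemma jacobian3 p q : 0 < -1 * face_jacobian E 3 p q.
Proof.
apply: (@face_jacobian_gt0 _ E 3 1 1 0 2).
- by rewrite sqrrN expr1n.
- by move=> x y; rewrite dotE; ring.
- by move=> x y; rewrite /cross mk3E; ring.
- by case: normal_high3.
- by move=> b; rewrite face_vertex3 vertex_coord0.
- by move=> b; rewrite face_vertex3 vertex_coord_gt0.
- by move=> b; rewrite face_vertex3 vertex_coord0.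
- by move=> b; rewrite face_vertex3 vertex_coord_gt0.
- by move=> b; rewrite face_vertex3 vertex_dot.
- by move=> b; rewrite face_vertex3 vertex_dot_lt.
Qed.

Lemma jacobian5 p q : 0 < 1 * face_jacobian E 5 p q.
Proof.
apply: (@face_jacobian_gt0 _ E 5 1 2 0 1).
- exact: expr1n.
- by move=> x y; rewrite dotE; ring.
- by move=> x y; rewrite /cross mk3E; ring.
- by case: normal_high5.
- by move=> b; rewrite face_vertex5 vertex_coord0.
- by move=> b; rewrite face_vertex5 vertex_coord_gt0.
- by move=> b; rewrite face_vertex5 vertex_coord0.
- by move=> b; rewrite face_vertex5 vertex_coord_gt0.
- by move=> b; rewrite face_vertex5 vertex_dot.
- by move=> b; rewrite face_vertex5 vertex_dot_lt.
Qed.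

Lemma sqrN1 : (-1 : R) ^+ 2 = 1. Proof. by rewrite sqrrN expr1n. Qed.

Definition normal_moment1 := normal_momentE (expr1n _ 2) jacobian1.
Definition normal_moment3 := normal_momentE sqrN1 jacobian3.
Definition normal_moment5 := normal_momentE (expr1n _ 2) jacobian5.

Definition area1_gt0 := area_gt0 (expr1n _ 2) jacobian1.
Definition area3_gt0 := area_gt0 sqrN1 jacobian3.
Definition area5_gt0 := area_gt0 (expr1n _ 2) jacobian5.
Definition affine_vanishing1 :=
  affine_vanishing_moment (expr1n _ 2) jacobian1.
Definition affine_vanishing3 :=
  affine_vanishing_moment sqrN1 jacobian3.
Definition affine_vanishing5 :=
  affine_vanishing_moment (expr1n _ 2) jacobian5.

(** The flux of the field x_l e_l through the whole boundary, that is, the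
    volume: on f_0, f_2 and f_4 either x_l or the l-th coordinate of the normal
    is zero. *)
Definition outflow (l : 'I_3) : R :=
  nu 1 0 l * mom 1 l + nu 3 0 l * mom 3 l + nu 5 0 l * mom 5 l.

Lemma coord_axes :
  (V true false false 0 0 = 1) * (V false true false 0 1 = 1)
  * (V false false true 0 2 = 1).
Proof. by case: hE => _ -> -> ->; rewrite /unit3 !mxE. Qed.

Lemma coord_zeros :
  ((V true false false 0 1 = 0) * (V true false false 0 2 = 0)
  * (V false true false 0 0 = 0) * (V false true false 0 2 = 0)
  * (V false false true 0 0 = 0) * (V false false true 0 1 = 0))
  * ((V true true false 0 2 = 0) * (V true false true 0 1 = 0)
  * (V false true true 0 0 = 0)).
Proof. by rewrite !vertex_coord0. Qed.

(** A polynomial identity in the nine free coordinates of the vertices. *)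
Lemma outflow_eq l l' : outflow l = outflow l'.
Proof.
suff eq0 : forall l, outflow l = outflow 0 by rewrite !eq0.
move=> {}l; rewrite /outflow.
move: l; apply: forall3 => //; rewrite ?normal_moment1 ?normal_moment3 ?normal_moment5 /mass /face_minor.
- rewrite !face_vertex1 !face_vertex3 !face_vertex5 !coord_axes !coord_zeros.
  move: (V true true false 0 0) (V true true false 0 1) (V true false true 0 0)
    (V true false true 0 2) (V false true true 0 1) (V false true true 0 2)
    (V true true true 0 0) (V true true true 0 1) (V true true true 0 2).
  by move=> x1 x2 x3 x4 x5 x6 x7 x8 x9; field.
- rewrite !face_vertex1 !face_vertex3 !face_vertex5 !coord_axes !coord_zeros.
  move: (V true true false 0 0) (V true true false 0 1) (V true false true 0 0)
    (V true false true 0 2) (V false true true 0 1) (V false true true 0 2)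
    (V true true true 0 0) (V true true true 0 1) (V true true true 0 2).
  by move=> x1 x2 x3 x4 x5 x6 x7 x8 x9; field.
Qed.

(** Since the three outflows are equal, it is enough that their sum is positive;
    this is the flux of the field x, whose normal component on a face is the
    constant offset of the face. *)
Lemma outflow_gt0 l : 0 < outflow l.
Proof.
have [off1 n1] := normal_high1; have [off3 n3] := normal_high3.
have [off5 n5] := normal_high5.
have plane m p q : - offset E m + dot (nu m) (face_vertex E m p q) = 0.
  by rewrite face_vertex_dot addNr.
have eq1 := affine_vanishing1 (plane 1).
have eq3 := affine_vanishing3 (plane 3).
have eq5 := affine_vanishing5 (plane 5).
have a1 := area1_gt0; have a3 := area3_gt0; have a5 := area5_gt0.
suff : 0 < outflow 0 + outflow 1 + outflow 2.
  rewrite (outflow_eq 0 l) (outflow_eq 1 l) (outflow_eq 2 l).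
  by move: (outflow l) => v; clear => v3; lra.
have -> : outflow 0 + outflow 1 + outflow 2
  = offset E 1 * area E 1 + offset E 3 * area E 3 + offset E 5 * area E 5.
  rewrite /outflow; move: eq1 eq3 eq5.
  move: (mom 1) (mom 3) (mom 5) (nu 1 0) (nu 3 0) (nu 5 0) => M1 M3 M5 u1 u3 u5.
  by move: (area E 1) (area E 3) (area E 5) => A1 A3 A5; clear => *; lra.
rewrite off1 off3 off5.
exact: addr_gt0 (addr_gt0 (mulr_gt0 n1 a1) (mulr_gt0 n3 a3)) (mulr_gt0 n5 a5).
Qed.

(** With (p, q) and (a, b) the first two coordinates of the ends of the edge
    common to f_1 and f_3, the difference of the two sides is the integral over
    z in [0, 1] of (p + (a - p) z) (q + (b - q) z).  Indeed, on f_1 it is the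
    integral of the derivative of x_1 x_2 along horizontal segments, and x_2 = 0
    at their other end. *)
Lemma horizontal_top_gt0 : nu 5 0 0 = 0 -> nu 5 0 1 = 0 ->
  nu 1 0 1 * mom 1 1 < nu 1 0 0 * mom 1 0.
Proof.
move=> n0 n1; have [off5 n2] := normal_high5.
have top p q : V p q true 0 2 = 1.
  have := face_vertex_dot E 5 p q; rewrite face_vertex5 dotE n0 n1 !mul0r !add0r off5.
  by rewrite -[RHS]mulr1; apply: mulfI; rewrite lt0r_neq0.
rewrite !normal_moment1 -subr_gt0 /mass /face_minor !face_vertex1.
rewrite !coord_axes !coord_zeros !top.
have := (@vertex_coord_gt0 true true false 0 isT, @vertex_coord_gt0 true true false 1 isT,
  @vertex_coord_gt0 true true true 0 isT, @vertex_coord_gt0 true true true 1 isT).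
move: (V true true false 0 0) (V true true false 0 1) (V true false true 0 0)
  (V true true true 0 0) (V true true true 0 1) => p q p' a b [[[p0 q0] a0] b0].
rewrite [ltRHS](_ : _ = p * q / 3 + (p * b + q * a) / 6 + a * b / 3); last by field.
move: (mulr_gt0 p0 q0) (mulr_gt0 p0 b0) (mulr_gt0 q0 a0) (mulr_gt0 a0 b0) => *.
lra.
Qed.
End HighFaces.

(** * Elements with zero flux *)

(** Counting coordinates from 0, Mil stands for nu_il int_{f_i} x_l on the sides
    i = 1, 3, and for int_{f_5} x_l when i = 5.  The two balance equations are the fluxes through
    f_1 and f_3.  Their sum is (al + be) v = 0, and with be = - al the first
    one is al times the factor that s and t keep away from zero. *)
Lemma balance_kernel (R : realFieldType)
  (v M10 M11 M30 M31 M50 M51 n50 n51 s t al be a4 a5 : R) :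
  0 < v -> M10 + M30 + n50 * M50 = v -> M11 + M31 + n51 * M51 = v ->
  M10 + n50 * M50 - M11 - n50 * t - n51 * s != 0 ->
  a4 = - (al * n50) -> a5 = - (be * n51) ->
  al * M10 + be * M11 + a4 * (- M50 + t) - a5 * s = 0 ->
  al * M30 + be * M31 - a4 * t + a5 * (- M51 + s) = 0 ->
  al = 0 /\ be = 0.
Proof.
move=> v0 V0 V1 K -> -> eq1 eq3.
have /eqP : (al + be) * v = 0.
  transitivity (al * (M10 + M30 + n50 * M50) + be * (M11 + M31 + n51 * M51)).
    by rewrite V0 V1; ring.
  by lra.
rewrite mulf_eq0 (gt_eqF v0) orbF addrC addr_eq0 => /eqP be_al.
move: eq1; rewrite be_al => eq1.
have /eqP : al * (M10 + n50 * M50 - M11 - n50 * t - n51 * s) = 0.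
  by rewrite -eq1; ring.
by rewrite mulf_eq0 (negPf K) orbF => /eqP al0; rewrite al0 oppr0.
Qed.

(** The three equations are the values of one affine function at three corners
    of a face, projected to (0, 0), (u, 0) and (0, v). *)
Lemma centered_coefficients0 (R : realFieldType) (x y c d u v : R) :
  0 < u -> 0 < v ->
  x * (0 - c) + y * (0 - d) = 0 -> x * (u - c) + y * (0 - d) = 0 ->
  x * (0 - c) + y * (v - d) = 0 -> x = 0 /\ y = 0.
Proof.
move=> u0 v0 e0 e1 e2.
have /eqP : x * u = 0 by lra.
have /eqP : y * v = 0 by lra.
by rewrite !mulf_eq0 (gt_eqF u0) (gt_eqF v0) !orbF => /eqP -> /eqP ->.
Qed.

Section FormalFlux.
Variables (R : realType) (E : hexahedron R) (s t : R).
Local Notation V := (vertex E).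
Local Notation nu := (normal E).
Local Notation mom := (moment E).

(** Coordinates on the trial space: the constant part and the matrix of the
    affine field, then the coefficients of the supplemental functions. *)
Definition trial_coef : Type := 'rV[R]_3 * 'M[R]_3 * 'rV[R]_6.
Implicit Type z : trial_coef.

Definition affine_field z (x : 'rV[R]_3) : 'rV[R]_3 := z.1.1 + x *m z.1.2.

Definition table_flux (m j : 'I_6) x : R :=
  if odd m then (flux_table E s t j x)`_(m./2) else 0.

(** The fluxes that the table prescribes, as affine functions on the whole space;
    no supplemental function need exist for them to make sense. *)
Definition formal_flux z (m : 'I_6) (x : 'rV[R]_3) : R :=
  dot (affine_field z x) (nu m) + \sum_(j < 6) z.2 0 j * table_flux m j x.

Lemma affine_fieldE z x k : affine_field z x 0 k
  = z.1.1 0 k + (x 0 0 * z.1.2 0 k + x 0 1 * z.1.2 1 k + x 0 2 * z.1.2 2 k).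
Proof. by rewrite mxE [in X in _ + X]mxE sum3. Qed.

Lemma sum6 (f : 'I_6 -> R) :
  \sum_(j < 6) f j = f 0 + f 1 + f 2 + f 3 + f 4 + f 5.
Proof.
rewrite !big_ord_recl big_ord0 addr0 !addrA.
by congr (f _ + f _ + f _ + f _ + f _ + f _); apply: val_inj.
Qed.

Lemma forall6 (P : 'I_6 -> Prop) :
  P 0 -> P 1 -> P 2 -> P 3 -> P 4 -> P 5 -> forall j, P j.
Proof.
move=> P0 P1 P2 P3 P4 P5 [[|[|[|[|[|[|//]]]]]] hj].
- by rewrite (_ : Ordinal hj = 0) //; apply: val_inj.
- by rewrite (_ : Ordinal hj = 1) //; apply: val_inj.
- by rewrite (_ : Ordinal hj = 2) //; apply: val_inj.
- by rewrite (_ : Ordinal hj = 3) //; apply: val_inj.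
- by rewrite (_ : Ordinal hj = 4) //; apply: val_inj.
- by rewrite (_ : Ordinal hj = 5) //; apply: val_inj.
Qed.

Lemma formal_flux1 z x : formal_flux z 1 x = dot (affine_field z x) (nu 1)
  + (z.2 0 0 * (x 0 1 - face_avg E 1 1) + z.2 0 1 * (x 0 2 - face_avg E 1 2)
   + z.2 0 4 * ((- area E 5 * face_avg E 5 0 + t) / area E 1)
   + z.2 0 5 * (- s / area E 1)).
Proof.
rewrite /formal_flux sum6; congr (_ + _).
by rewrite /table_flux /flux_table /= !mulr0 !addr0.
Qed.

Lemma formal_flux3 z x : formal_flux z 3 x = dot (affine_field z x) (nu 3)
  + (z.2 0 2 * (x 0 0 - face_avg E 3 0) + z.2 0 3 * (x 0 2 - face_avg E 3 2)
   + z.2 0 4 * (- t / area E 3)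
   + z.2 0 5 * ((- area E 5 * face_avg E 5 1 + s) / area E 3)).
Proof.
rewrite /formal_flux sum6; congr (_ + _).
by rewrite /table_flux /flux_table /= !mulr0 !add0r.
Qed.

Lemma formal_flux5 z x : formal_flux z 5 x = dot (affine_field z x) (nu 5)
  + (z.2 0 4 * x 0 0 + z.2 0 5 * x 0 1).
Proof.
rewrite /formal_flux sum6; congr (_ + _).
by rewrite /table_flux /flux_table /= !mulr0 !add0r.
Qed.

Hypothesis hE : normalized E.
Hypothesis nondegenerate :
  nu 1 0 0 * mom 1 0 + nu 5 0 0 * mom 5 0 - nu 1 0 1 * mom 1 1
  - nu 5 0 0 * t - nu 5 0 1 * s != 0.

Lemma face_avgE m l : 0 < area E m -> area E m * face_avg E m l = mom m l.
Proof. by move=> A0; rewrite /face_avg -/(mom m l) mulrC divfK ?gt_eqF. Qed.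

Section Kernel.
Variable z : trial_coef.
Hypothesis flux0 : forall m a b c, incident m a b c ->
  formal_flux z m (V a b c) = 0.
Let C (k : 'I_3) : R := z.1.1 0 k.
Let W (i k : 'I_3) : R := z.1.2 i k.
Let al : R := W 0 0.
Let be : R := W 1 1.

Lemma vertex_axis (i : 'I_3) : V (i == 0) (i == 1) (i == 2) = unit3 R i.
Proof. by case: hE => _ V0 V1 V2; move: i; apply: forall3. Qed.

(** On f_{2k} the supplemental functions have no flux, and the normal is - e_k.
    *)
Lemma low_flux (k : 'I_3) a b c : ~~ nth false [:: a; b; c] k ->
  affine_field z (V a b c) 0 k = 0.
Proof.
move=> kth.
have lt6 : (k.*2 < 6)%N by rewrite -[6%N]/(3.*2)%N ltn_double.
have inc : incident (Ordinal lt6) a b c.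
  by move: k lt6 kth; apply: forall3 => lt6.
have [_ dotk] := @normal_low _ _ hE k (Ordinal lt6) erefl.
have := flux0 inc; rewrite /formal_flux big1 => [|j _]; last first.
  by rewrite /table_flux /= odd_double mulr0.
rewrite addr0 [dot _ _](_ : _ = dot (nu (Ordinal lt6)) (affine_field z (V a b c))).
  by rewrite dotk => /eqP; rewrite oppr_eq0 => /eqP.
by rewrite !dotE; ring.
Qed.

Lemma constants0 k : C k = 0.
Proof.
have V0 : V false false false = 0 by case: hE.
have := @low_flux k false false false.
rewrite V0 affine_fieldE !mxE !mul0r !addr0; apply.
by move: k; apply: forall3.
Qed.

Lemma off_diagonal0 i k : i != k -> W i k = 0.
Proof.
move=> ik; have := @low_flux k (i == 0) (i == 1) (i == 2).
rewrite vertex_axis affine_fieldE -/(C k) constants0 add0r.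
have -> : unit3 R i 0 0 * z.1.2 0 k + unit3 R i 0 1 * z.1.2 1 k
   + unit3 R i 0 2 * z.1.2 2 k = W i k.
  transitivity (dot (\row_l W l k) (unit3 R i)); last by rewrite dot_unit3 mxE.
  by rewrite dotE !mxE /W; ring.
by apply; move: i k ik; apply: forall3; apply: forall3.
Qed.

Lemma diagonal_field x k : affine_field z x 0 k = W k k * x 0 k.
Proof.
rewrite affine_fieldE -/(C k) constants0 add0r -/(W 0 k) -/(W 1 k) -/(W 2 k).
move: k; apply: forall3.
- by rewrite (@off_diagonal0 1 0) // (@off_diagonal0 2 0) //; ring.
- by rewrite (@off_diagonal0 0 1) // (@off_diagonal0 2 1) //; ring.
- by rewrite (@off_diagonal0 0 2) // (@off_diagonal0 1 2) //; ring.
Qed.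

Lemma diagonal_dot x n : dot (affine_field z x) n
  = al * n 0 0 * x 0 0 + be * n 0 1 * x 0 1 + W 2 2 * n 0 2 * x 0 2.
Proof. by rewrite dotE !diagonal_field /al /be; ring. Qed.

Lemma top_flux a b : al * nu 5 0 0 * V a b true 0 0
  + be * nu 5 0 1 * V a b true 0 1 + W 2 2 * nu 5 0 2 * V a b true 0 2
  + (z.2 0 4 * V a b true 0 0 + z.2 0 5 * V a b true 0 1) = 0.
Proof. by rewrite -diagonal_dot -formal_flux5 flux0. Qed.

Lemma top_diagonal0 : W 2 2 = 0.
Proof.
have := top_flux false false; rewrite !(coord_axes hE) !(coord_zeros hE).
have [_ n5] := normal_high5 hE.
rewrite !mulr0 !addr0 add0r mulr1 => /eqP.
by rewrite mulf_eq0 (gt_eqF n5) orbF => /eqP.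
Qed.

Lemma top_coefficients :
  z.2 0 4 = - (al * nu 5 0 0) /\ z.2 0 5 = - (be * nu 5 0 1).
Proof.
split.
- have := top_flux true false; rewrite !(coord_zeros hE) top_diagonal0.
  rewrite !mul0r !mulr0 !addr0 -mulrDl => /eqP.
  have x0 := @vertex_coord_gt0 _ _ hE true false true 0 isT.
  by rewrite mulf_eq0 (gt_eqF x0) orbF addrC addr_eq0 => /eqP.
- have := top_flux false true; rewrite !(coord_zeros hE) top_diagonal0.
  rewrite !mul0r !mulr0 !addr0 !add0r -mulrDl => /eqP.
  have x0 := @vertex_coord_gt0 _ _ hE false true true 1 isT.
  by rewrite mulf_eq0 (gt_eqF x0) orbF addrC addr_eq0 => /eqP.
Qed.

(** The integral of the flux over f_1.  The averages in the table cancel the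
    contributions of sigma_0 and sigma_1, and the divisions by the area turn
    the fluxes of sigma_4 and sigma_5 into constants. *)
Lemma side_balance1 : al * (nu 1 0 0 * mom 1 0) + be * (nu 1 0 1 * mom 1 1)
  + z.2 0 4 * (- mom 5 0 + t) - z.2 0 5 * s = 0.
Proof.
have A1 := area1_gt0 hE; have A5 := area5_gt0 hE.
have avg11 := face_avgE 1 A1; have avg12 := face_avgE 2 A1.
have avg50 := face_avgE 0 A5.
pose u := mk3 (al * nu 1 0 0) (be * nu 1 0 1 + z.2 0 0) (z.2 0 1).
pose c := - z.2 0 0 * face_avg E 1 1 - z.2 0 1 * face_avg E 1 2
  + z.2 0 4 * ((- area E 5 * face_avg E 5 0 + t) / area E 1)
  + z.2 0 5 * (- s / area E 1).
have : c * area E 1 + (u 0 0 * mom 1 0 + u 0 1 * mom 1 1 + u 0 2 * mom 1 2) = 0.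
  apply: (affine_vanishing1 hE) => p q.
  have := @flux0 1 true p q isT; rewrite face_vertex1.
  rewrite formal_flux1 diagonal_dot top_diagonal0 [dot u _]dotE !mk3E /c => <-.
  move: (V true p q) => x; generalize (area E 1) (area E 5) (face_avg E 1 1)
    (face_avg E 1 2) (face_avg E 5 0) => *.
  ring.
rewrite !mk3E /c -avg11 -avg12 -avg50; move: (lt0r_neq0 A1).
generalize (area E 1) (area E 5) (face_avg E 1 1) (face_avg E 1 2)
  (face_avg E 5 0) (mom 1 0) => A A' c1 c2 c0 M An0 eq0.
by rewrite -eq0; field.
Qed.

Lemma side_balance3 : al * (nu 3 0 0 * mom 3 0) + be * (nu 3 0 1 * mom 3 1)
  - z.2 0 4 * t + z.2 0 5 * (- mom 5 1 + s) = 0.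
Proof.
have A3 := area3_gt0 hE; have A5 := area5_gt0 hE.
have avg30 := face_avgE 0 A3; have avg32 := face_avgE 2 A3.
have avg51 := face_avgE 1 A5.
pose u := mk3 (al * nu 3 0 0 + z.2 0 2) (be * nu 3 0 1) (z.2 0 3).
pose c := - z.2 0 2 * face_avg E 3 0 - z.2 0 3 * face_avg E 3 2
  + z.2 0 4 * (- t / area E 3)
  + z.2 0 5 * ((- area E 5 * face_avg E 5 1 + s) / area E 3).
have : c * area E 3 + (u 0 0 * mom 3 0 + u 0 1 * mom 3 1 + u 0 2 * mom 3 2) = 0.
  apply: (affine_vanishing3 hE) => p q.
  have := @flux0 3 p true q isT; rewrite face_vertex3.
  rewrite formal_flux3 diagonal_dot top_diagonal0 [dot u _]dotE !mk3E /c => <-.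
  move: (V p true q) => x; generalize (area E 3) (area E 5) (face_avg E 3 0)
    (face_avg E 3 2) (face_avg E 5 1) => *.
  ring.
rewrite !mk3E /c -avg30 -avg32 -avg51; move: (lt0r_neq0 A3).
generalize (area E 3) (area E 5) (face_avg E 3 0) (face_avg E 3 2)
  (face_avg E 5 1) (mom 3 1) => A A' c1 c2 c0 M An0 eq0.
by rewrite -eq0; field.
Qed.

Lemma diagonal0 : al = 0 /\ be = 0.
Proof.
have [a4 a5] := top_coefficients.
apply: (balance_kernel (outflow_gt0 hE 0) erefl (outflow_eq hE 1 0) _ a4 a5
  side_balance1 side_balance3).
by move: nondegenerate; congr (_ != 0); ring.
Qed.

(** Once the affine field and a_4, a_5 are zero, the fluxes through f_1 and f_3
    involve only (a_0, a_1) and (a_2, a_3). *)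
Lemma formal_flux_kernel : z = 0.
Proof.
have [al0 be0] := diagonal0; have [a4 a5] := top_coefficients.
move: a4 a5; rewrite al0 be0 !mul0r oppr0 => a4 a5.
have W0 : z.1.2 = 0.
  apply/matrixP => i k; rewrite [RHS]mxE; have [<-{k}|ik] := eqVneq i k.
    by move: i; apply: forall3; [exact: al0 | exact: be0 | exact: top_diagonal0].
  exact: off_diagonal0.
have c0 : z.1.1 = 0.
  by apply/rowP => k; rewrite [RHS]mxE; exact: constants0.
have dot00 n : dot 0 n = 0 :> R by rewrite dotE !mxE; ring.
have side1 p q : z.2 0 0 * (V true p q 0 1 - face_avg E 1 1)
   + z.2 0 1 * (V true p q 0 2 - face_avg E 1 2) = 0.
  have := @flux0 1 true p q isT; rewrite formal_flux1 /affine_field W0 c0.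
  by rewrite mulmx0 addr0 dot00 add0r a4 a5 !mul0r !addr0.
have side3 p q : z.2 0 2 * (V p true q 0 0 - face_avg E 3 0)
   + z.2 0 3 * (V p true q 0 2 - face_avg E 3 2) = 0.
  have := @flux0 3 p true q isT; rewrite formal_flux3 /affine_field W0 c0.
  by rewrite mulmx0 addr0 dot00 add0r a4 a5 !mul0r !addr0.
have [a00 a01] : z.2 0 0 = 0 /\ z.2 0 1 = 0.
  have := (side1 false false, side1 true false, side1 false true).
  rewrite !(coord_zeros hE) => -[[e0 e1] e2]; apply: centered_coefficients0 e0 e1 e2.
    exact: (vertex_coord_gt0 hE).
  exact: (vertex_coord_gt0 hE).
have [a02 a03] : z.2 0 2 = 0 /\ z.2 0 3 = 0.
  have := (side3 false false, side3 true false, side3 false true).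
  rewrite !(coord_zeros hE) => -[[e0 e1] e2]; apply: centered_coefficients0 e0 e1 e2.
    exact: (vertex_coord_gt0 hE).
  exact: (vertex_coord_gt0 hE).
have a0 : z.2 = 0 by apply/rowP; apply: forall6; rewrite [RHS]mxE.
by rewrite [z]surjective_pairing [z.1]surjective_pairing W0 c0 a0.
Qed.
End Kernel.

End FormalFlux.

(** * Affine functions on the faces *)

Section AffineFunctions.
Variable R : realType.
Implicit Types (f g : 'rV[R]_3 -> R).

Lemma P1_cst (c : R) : P1 (fun _ : 'rV[R]_3 => c).
Proof.
by exists c, 0; apply/funext => x; rewrite dotE !mxE !mul0r !addr0.
Qed.

Lemma P1_coord l : P1 (fun x : 'rV[R]_3 => x 0 l).
Proof.
exists 0, (unit3 R l); apply/funext => x.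
rewrite add0r -[LHS](dot_unit3 x) !dotE; ring.
Qed.

Lemma P1D f g : P1 f -> P1 g -> P1 (fun x => f x + g x).
Proof.
move=> [c [u ->]] [d [v ->]]; exists (c + d), (u + v).
by apply/funext => x; rewrite !dotE !mxE; ring.
Qed.

Lemma P1Z (k : R) f : P1 f -> P1 (fun x => k * f x).
Proof.
move=> [c [u ->]]; exists (k * c), (k *: u).
by apply/funext => x; rewrite !dotE !mxE; ring.
Qed.

Lemma P1B f g : P1 f -> P1 g -> P1 (fun x => f x - g x).
Proof.
move=> Pf Pg; have := P1D Pf (P1Z (-1) Pg).
by congr P1; apply/funext => x; rewrite mulN1r.
Qed.

Lemma P1_sum n (f : 'I_n -> 'rV[R]_3 -> R) :
  (forall i, P1 (f i)) -> P1 (fun x => \sum_(i < n) f i x).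
Proof.
elim: n f => [|n IH] f Pf.
  have -> : (fun x => \sum_(i < 0) f i x) = (fun=> 0).
    by apply/funext => x; rewrite big_ord0.
  exact: P1_cst.
have := P1D (Pf ord0) (IH _ (fun i => Pf (lift ord0 i))).
by congr P1; apply/funext => x; rewrite big_ord_recl.
Qed.

Lemma P1_nth f g h i : P1 f -> P1 g -> P1 h ->
  P1 (fun x => [:: f x; g x; h x]`_i).
Proof.
by case: i => [|[|[|i]]] // *; under eq_fun do rewrite nth_default //;
  exact: P1_cst.
Qed.

Lemma P1_flux_table (E : hexahedron R) s t j i :
  P1 (fun x => (flux_table E s t j x)`_i).
Proof.
move: j; apply: forall6; apply: P1_nth; try exact: P1_cst;
  try exact: P1_coord; apply: P1B; (exact: P1_coord || exact: P1_cst).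
Qed.

(** The three points project along the k-th axis to (0, 0), (a, 0) and (0, b) with
    a and b nonzero, and the plane n . x = const is a graph over the other two
    axes; so the three points span it. *)
Lemma affine_plane_eq0 (k i j : 'I_3) (n u F00 F10 F01 x : 'rV[R]_3) (c : R) :
  (forall x y : 'rV[R]_3, dot x y = x 0 k * y 0 k + x 0 i * y 0 i + x 0 j * y 0 j) ->
  n 0 k != 0 ->
  F00 0 i = 0 -> F00 0 j = 0 ->
  F10 0 i != 0 -> F10 0 j = 0 -> F01 0 i = 0 -> F01 0 j != 0 ->
  dot n F00 = dot n x -> dot n F10 = dot n x -> dot n F01 = dot n x ->
  c + dot u F00 = 0 -> c + dot u F10 = 0 -> c + dot u F01 = 0 ->
  c + dot u x = 0.
Proof.
move=> dotk nk F00i F00j F10i F10j F01i F01j.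
rewrite !dotk F00i F00j F10j F01i !mulr0 !addr0.
move: (n 0 k) nk (n 0 i) (n 0 j) (u 0 k) (u 0 i) (u 0 j) => nk nk0 ni nj uk ui uj.
move: (F00 0 k) (F10 0 k) (F01 0 k) (x 0 k) (x 0 i) (x 0 j) => z0 z1 z2 xk xi xj.
move: (F10 0 i) F10i (F01 0 j) F01j => a a0 b b0 n0 n1 n2 u0 u1 u2.
have D0 : a * b * (xk - z0) - xi * b * (z1 - z0) - xj * a * (z2 - z0) = 0.
  apply: (mulfI nk0); rewrite mulr0.
  transitivity (a * b * ((nk * xk + ni * xi + nj * xj) - nk * z0)
     - xi * b * ((nk * z1 + ni * a) - nk * z0)
     - xj * a * ((nk * z2 + nj * b) - nk * z0)); first by ring.
  by rewrite n0 n1 n2 !subrr !mulr0 !subr0.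
apply: (mulfI (mulf_neq0 a0 b0)); rewrite mulr0.
transitivity (a * b * (c + uk * z0)
  + uk * (a * b * (xk - z0) - xi * b * (z1 - z0) - xj * a * (z2 - z0))
  + xi * b * ((c + (uk * z1 + ui * a)) - (c + uk * z0))
  + xj * a * ((c + (uk * z2 + uj * b)) - (c + uk * z0))); first by ring.
by rewrite D0 u0 u1 u2 !subr0 !mulr0 !addr0.
Qed.

End AffineFunctions.

Section FluxIsomorphism.
Variables (R : realType) (E : hexahedron R).
Hypothesis hE : normalized E.
Local Notation V := (vertex E).
Local Notation nu := (normal E).

Lemma normal_low_neq0 (k : 'I_3) (m : 'I_6) : m = k.*2 :> nat -> nu m 0 k != 0.
Proof.
move=> mk; have [_ dotk] := normal_low hE mk.
by rewrite -dot_unit3 dotk /unit3 mxE !eqxx oppr_eq0 oner_eq0.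
Qed.

Lemma affine_face_eq0 m f : P1 f ->
  f (face_vertex E m false false) = 0 -> f (face_vertex E m true false) = 0 ->
  f (face_vertex E m false true) = 0 ->
  forall x, dot (nu m) x = offset E m -> f x = 0.
Proof.
move=> [c [u ->]] f00 f10 f01 x xm.
move: m x xm f00 f10 f01.
have corner m p q x : dot (nu m) x = offset E m ->
    dot (nu m) (face_vertex E m p q) = dot (nu m) x.
  by move=> ->; exact: face_vertex_dot.
apply: forall6 => x xm f00 f10 f01.
- apply: (@affine_plane_eq0 _ 0 1 2 (nu 0)) f00 f10 f01;
    try exact: corner; try exact: (vertex_coord0 hE);
    try exact/lt0r_neq0/(vertex_coord_gt0 hE).
  + exact: dotE.
  + exact: normal_low_neq0.
- apply: (@affine_plane_eq0 _ 0 1 2 (nu 1)) f00 f10 f01;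
    try exact: corner; try exact: (vertex_coord0 hE);
    try exact/lt0r_neq0/(vertex_coord_gt0 hE).
  + exact: dotE.
  + by apply/lt0r_neq0; case: (normal_high1 hE).
- apply: (@affine_plane_eq0 _ 1 0 2 (nu 2)) f00 f10 f01;
    try exact: corner; try exact: (vertex_coord0 hE);
    try exact/lt0r_neq0/(vertex_coord_gt0 hE).
  + by move=> a b; rewrite dotE; ring.
  + exact: normal_low_neq0.
- apply: (@affine_plane_eq0 _ 1 0 2 (nu 3)) f00 f10 f01;
    try exact: corner; try exact: (vertex_coord0 hE);
    try exact/lt0r_neq0/(vertex_coord_gt0 hE).
  + by move=> a b; rewrite dotE; ring.
  + by apply/lt0r_neq0; case: (normal_high3 hE).
- apply: (@affine_plane_eq0 _ 2 0 1 (nu 4)) f00 f10 f01;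
    try exact: corner; try exact: (vertex_coord0 hE);
    try exact/lt0r_neq0/(vertex_coord_gt0 hE).
  + by move=> a b; rewrite dotE; ring.
  + exact: normal_low_neq0.
- apply: (@affine_plane_eq0 _ 2 0 1 (nu 5)) f00 f10 f01;
    try exact: corner; try exact: (vertex_coord0 hE);
    try exact/lt0r_neq0/(vertex_coord_gt0 hE).
  + by move=> a b; rewrite dotE; ring.
  + by apply/lt0r_neq0; case: (normal_high5 hE).
Qed.

(** * The flux map as a linear bijection *)

Section Dofs.
Variables (s t : R).
Hypothesis nondegenerate :
  nu 1 0 0 * moment E 1 0 + nu 5 0 0 * moment E 5 0 - nu 1 0 1 * moment E 1 1
  - nu 5 0 0 * t - nu 5 0 1 * s != 0.
Local Notation flux_of := (formal_flux E s t).

Lemma P1_formal_flux z m : P1 (flux_of z m).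
Proof.
apply: P1D.
  have field_l l : P1 (fun x => affine_field z x 0 l).
    under eq_fun do rewrite affine_fieldE.
    by do !apply: P1D; try exact: P1_cst;
      under eq_fun do rewrite mulrC; apply/P1Z/P1_coord.
  under eq_fun do rewrite dotE !(mulrC _ (nu m 0 _)).
  by do !apply: P1D; apply: P1Z.
apply: P1_sum => j; apply: P1Z; rewrite /table_flux.
by case: odd; [exact: P1_flux_table | exact: P1_cst].
Qed.

Lemma formal_flux_linear (k : R) (z1 z2 : trial_coef R) m x :
  flux_of (k *: z1 + z2) m x = k * flux_of z1 m x + flux_of z2 m x.
Proof.
set z := k *: z1 + z2.
have zc l : z.1.1 0 l = k * z1.1.1 0 l + z2.1.1 0 l by rewrite !mxE.
have zW i l : z.1.2 i l = k * z1.1.2 i l + z2.1.2 i l by rewrite !mxE.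
have za j : z.2 0 j = k * z1.2 0 j + z2.2 0 j by rewrite !mxE.
rewrite /formal_flux mulrDr addrACA; congr (_ + _).
  by rewrite !dotE !affine_fieldE !zc !zW; ring.
rewrite mulr_sumr -big_split; apply: eq_bigr => j _.
by rewrite za mulrDl mulrA.
Qed.

(** Three corners of each face, at which an affine function on the face is
    determined by its values; they turn a family of six fluxes into a 6 x 3
    matrix. *)
Definition corner (m : 'I_6) (i : 'I_3) := face_vertex E m (i == 1) (i == 2).

Definition corner_fluxes (z : trial_coef R) : 'M[R]_(6, 3) :=
  \matrix_(m, i) flux_of z m (corner m i).

Lemma corner_fluxes_linear : linear corner_fluxes.
Proof.
by move=> k z1 z2; apply/matrixP => m i; rewrite !mxE formal_flux_linear.
Qed.

HB.instance Definition _ := GRing.isLinear.Build R (trial_coef R) 'M[R]_(6, 3)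
  *:%R corner_fluxes corner_fluxes_linear.

Lemma corner_affine_eq0 m f : P1 f -> (forall i, f (corner m i) = 0) ->
  forall x, dot (nu m) x = offset E m -> f x = 0.
Proof.
move=> Pf f0; apply: (affine_face_eq0 Pf);
  [exact: (f0 0) | exact: (f0 1) | exact: (f0 2)].
Qed.

Lemma corner_fluxes_inj : injective corner_fluxes.
Proof.
apply: raddf_inj => z Lz.
apply: (formal_flux_kernel hE nondegenerate) => m a b c abc.
apply: (corner_affine_eq0 (P1_formal_flux z m)) => [i|].
  by move/matrixP/(_ m i): Lz; rewrite !mxE => <-.
exact: vertex_dot.
Qed.

(** Both spaces have dimension 18 = 3 + 9 + 6 = 6 * 3. *)
Lemma corner_fluxes_surj (w : 'M[R]_(6, 3)) : exists z, corner_fluxes z = w.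
Proof.
have ker0 : lker (linfun corner_fluxes) == 0%VS.
  by apply/lker0P => z1 z2; rewrite !lfunE; exact: corner_fluxes_inj.
have full : limg (linfun corner_fluxes) = fullv.
  apply/eqP; rewrite eqEdim subvf /= limg_dim_eq; last first.
    by rewrite (eqP ker0) capv0.
  by rewrite !dimvf.
have : w \in limg (linfun corner_fluxes) by rewrite full memvf.
by case/memv_imgP => z _ ->; exists z; rewrite lfunE.
Qed.

End Dofs.

End FluxIsomorphism.

(** * From formal fluxes to the supplemental functions *)

Section Realization.
Variables (R : realType) (E : hexahedron R) (s t : R).
Variable sigma : 'I_6 -> 'rV[R]_3 -> 'rV[R]_3.
Hypothesis sigma_fluxes : prescribed_fluxes E s t sigma.
Local Notation nu := (normal E).

Definition trial_field (z : trial_coef R) : 'rV[R]_3 -> 'rV[R]_3 :=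
  combination (affine_field z) sigma (fun j => z.2 0 j).

Lemma P1_vec_affine p a : P1_vec p ->
  exists z : trial_coef R, p = affine_field z /\ a = (fun j => z.2 0 j).
Proof.
move=> Pp.
have [c pc] := choice Pp; have [w pw] := choice pc.
exists (\row_l c l, \matrix_(i, l) w l 0 i, \row_j a j); split.
  apply/funext => x; apply/rowP => l.
  have /(congr1 (fun f => f x)) /= -> := pw l.
  by rewrite affine_fieldE /= !mxE dotE; ring.
by apply/funext => j; rewrite mxE.
Qed.

Lemma affine_field_P1 (z : trial_coef R) : P1_vec (affine_field z).
Proof.
move=> l; exists (z.1.1 0 l), (\row_i z.1.2 i l); apply/funext => x.
by rewrite affine_fieldE dotE !mxE; ring.
Qed.

Lemma sigma_table_flux m j x : face E m x ->
  flux E (sigma j) m x = table_flux E s t m j x.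
Proof.
move=> mx; have half_lt : (m./2 < 3)%N by rewrite ltn_half_double.
have [low high] := sigma_fluxes j (Ordinal half_lt).
rewrite /table_flux; case: ifPn => odd_m.
  by apply: high => //=; rewrite -[LHS]odd_double_half odd_m.
by apply: low => //=; rewrite -[LHS]odd_double_half (negPf odd_m).
Qed.

Lemma flux_trial_field z m x : face E m x ->
  flux E (trial_field z) m x = formal_flux E s t z m x.
Proof.
move=> mx; rewrite /flux /trial_field /combination /formal_flux.
have -> : dot (affine_field z x + \sum_(j < 6) z.2 0 j *: sigma j x) (nu m)
    = dot (affine_field z x) (nu m)
      + \sum_(j < 6) z.2 0 j * dot (sigma j x) (nu m).
  have dot_suml n : dot (\sum_(j < 6) z.2 0 j *: sigma j x) n
      = \sum_(j < 6) z.2 0 j * dot (sigma j x) n.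
    rewrite dotE !summxE !mulr_suml -!big_split; apply: eq_bigr => j _.
    by rewrite dotE !mxE /=; ring.
  rewrite -dot_suml; move: (\sum_(j < 6) _) => v.
  by rewrite !dotE !mxE; ring.
by congr (_ + _); apply: eq_bigr => j _; rewrite -sigma_table_flux.
Qed.

Lemma onE (V : zmodType) (A : set 'rV[R]_3) (f : 'rV[R]_3 -> V) x :
  A x -> on A f x = f x.
Proof. by move=> Ax; rewrite /on /patch mem_set. Qed.

Lemma eq_on (V : zmodType) (A : set 'rV[R]_3) (f g : 'rV[R]_3 -> V) :
  (forall x, A x -> f x = g x) -> on A f = on A g.
Proof.
move=> fg; apply/funext => x; rewrite /on /patch.
by case: ifPn => // xA; apply: fg; rewrite -in_setE.
Qed.

Lemma flux_map_trial z m : flux_map E (on (body E) (trial_field z)) m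
  = on (face E m) (formal_flux E s t z m).
Proof.
apply: eq_on => x mx; rewrite -flux_trial_field // /flux onE //.
by case: mx.
Qed.

End Realization.

(** If the normal of f_5 has a nonzero first or second coordinate, one of s and t
    can be adjusted so that the expression is 1; otherwise s = t = 0 works. *)
Lemma balance_parameters (R : realType) (E : hexahedron R) :
  normalized E -> exists s t : R,
  let: (n, M) := (normal E, moment E) in
  n 1 0 0 * M 1 0 + n 5 0 0 * M 5 0 - n 1 0 1 * M 1 1
  - n 5 0 0 * t - n 5 0 1 * s != 0.
Proof.
move=> hE.
have shift (a b : R) : b != 0 -> a - b * ((a - 1) / b) != 0.
  by move=> b0; rewrite mulrC divfK // subKr oner_eq0.
have [n0|n0] := eqVneq (normal E 5 0 0) 0; last first.
  exists 0; eexists; rewrite mulr0 subr0; exact: shift n0.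
have [n1|n1] := eqVneq (normal E 5 0 1) 0; last first.
  eexists; exists 0; rewrite mulr0 subr0; exact: shift n1.
exists 0, 0; rewrite n0 n1 !mul0r addr0 !subr0 subr_eq0.
by rewrite gt_eqF // (horizontal_top_gt0 hE n0 n1).
Qed.

Theorem theorem1 (R : realType) (E : hexahedron R) (hE : normalized E) :
  exists s t : R,
    forall sigma : 'I_6 -> 'rV[R]_3 -> 'rV[R]_3,
      (forall j, has_normal_traces E (sigma j)) ->
      (forall j, divergence_free E (sigma j)) ->
      prescribed_fluxes E s t sigma ->
      independent_flux_dofs E sigma.
Proof.
have [s [t K]] := balance_parameters hE.
exists s, t => sigma _ _ fluxes.
have vertex_face m a b c : incident m a b c -> face E m (vertex E a b c).
  by move/(vertex_on_face E a b c m).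
split.
  move=> p a Pp; have [z [-> ->]] := P1_vec_affine a Pp => comb0.
  suff -> : z = 0.
    split=> [x|j]; last by rewrite mxE.
    by rewrite /affine_field mulmx0 addr0.
  apply: (formal_flux_kernel hE K) => m b1 b2 b3 inc.
  have mx := vertex_face m b1 b2 b3 inc.
  rewrite -(flux_trial_field fluxes z mx) /flux /trial_field comb0.
    by rewrite dotE !mxE !mul0r !addr0.
  by case: mx.
have trialP u : trial_space E sigma u ->
    exists z, u = on (body E) (trial_field sigma z).
  by move=> [p [a [Pp ->]]]; have [z [-> ->]] := P1_vec_affine a Pp; exists z.
split.
- move=> u /trialP[z ->] m /=; exists (formal_flux E s t z m).
    exact: P1_formal_flux.
  exact: flux_map_trial.
- move=> u v /set_mem/trialP[z1 ->] /set_mem/trialP[z2 ->] eqf.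
  suff -> : z1 = z2 by [].
  apply: (corner_fluxes_inj hE K); apply/matrixP => m i; rewrite !mxE.
  have /(congr1 (fun q => q m (corner E m i))) := eqf.
  by rewrite !(flux_map_trial fluxes) !onE //; exact: face_vertex_on.
- move=> q Pq.
  have [f Pf qf] : exists2 f, forall m, P1 (f m) &
      forall m, q m = on (face E m) (f m).
    have /choice[f fP] : forall m, exists p, P1 p /\ q m = on (face E m) p.
      by move=> m; have [p] := Pq m; exists p.
    by exists f => m; case: (fP m).
  have [z zf] := corner_fluxes_surj hE K (\matrix_(m, i) f m (corner E m i)).
  exists (on (body E) (trial_field sigma z)).
    by exists (affine_field z), (fun j => z.2 0 j); split; first exact: affine_field_P1.
  apply/funext => m; rewrite (flux_map_trial fluxes) qf; apply: eq_on => x mx.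
  apply/eqP; rewrite -subr_eq0; apply/eqP.
  apply: (corner_affine_eq0 hE (m := m)
    (P1B (P1_formal_flux E s t z m) (Pf m))) => [i|].
    by move/matrixP/(_ m i): zf; rewrite !mxE => zmi; rewrite zmi subrr.
  by case: mx.
Qed.
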